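(* The Boolean algebra $\mathfrak{T}_{\mathcal{V}}/\mathrm{Fin}$ does not support a measure.
   Context: Natural numbers are identified with the sets of their predecessors, $n=\{0,\dots,n-1\}$; in particular $2^n=\{0,\dots,2^n-1\}$. For $S\subseteq\omega\times\omega$ put $S(n)=\{m:(n,m)\in S\}$. Let $\mathcal{S}=\{S\subseteq\omega\times\omega: |S(n)|<2^n \text{ for all } n\}$ (the set of slaloms). Let $\mathcal{V}$ be the set of all $S\in\mathcal{S}$ such that $S(n)\subseteq 2^n$ for each $n$ and $\lim_n \frac{1}{2^n}|S(n)|=0$. Let $\Omega=\{(S,n): n\in\omega,\ S\in\mathcal{S},\ S\subseteq n\times 2^n\}$. For $A\subseteq\omega\times\omega$ let $T_A=\{(T,n)\in\Omega: A\cap(n\times 2^n)\subseteq T\}$. For $(S,n)\in\Omega$ let $T_{(S,n)}=\{(T,m)\in\Omega: m\geq n,\ T\cap(n\times 2^n)=S\}$. $\mathfrak{T}_{\mathcal{V}}$ is the subalgebra of $\mathcal{P}(\Omega)$ generated by $\{T_A: A\in\mathcal{V}\}\cup\{T_{(S,n)}:(S,n)\in\Omega\}$, and $\mathfrak{T}_{\mathcal{V}}/\mathrm{Fin}$ is its quotient by the ideal of its finite members. A measure on a Boolean algebra is a finite, finitely additive, non-negative measure; a Boolean algebra supports a measure if there is a measure on it which is strictly positive on every nonzero element. *)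

(* Defs.v *)
From HB Require Import structures.
From mathcomp Require Import all_boot all_order all_algebra.
From mathcomp Require Import generic_quotient finmap.
From mathcomp Require Import all_classical all_reals all_analysis.

Set Implicit Arguments.
Unset Strict Implicit.
Unset Printing Implicit Defensive.

Import Order.Theory GRing.Theory Num.Theory.
Import numFieldNormedType.Exports.

Local Open Scope classical_set_scope.
Local Open Scope ring_scope.

(* Boolean algebras are the types [ctbDistrLatticeType d] of order.v
   (complemented distributive lattices with bottom and top). *)

Section Subalgebra.
Context {d : Order.disp_t} {B : ctbDistrLatticeType d}.
Local Open Scope order_scope.

Definition subalgebra_closed (A : set B) : Prop :=
  [/\ A \bot, A \top, forall x, A x -> A (~` x),
      forall x y, A x -> A y -> A (x `&` y) &
      forall x y, A x -> A y -> A (x `|` y)].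

Definition generated_subalgebra (G : set B) : set B :=
  smallest subalgebra_closed G.

Lemma generated_subalgebraP (G : set B) :
  subalgebra_closed (generated_subalgebra G).
Proof.
split.
- by move=> A [[]].
- by move=> A [[]].
- by move=> x Gx A GA; have [[_ _ cA _ _] _] := GA; apply: cA; exact: Gx.
- move=> x y Gx Gy A GA; have [[_ _ _ iA _] _] := GA.
  by apply: iA; [exact: Gx|exact: Gy].
- move=> x y Gx Gy A GA; have [[_ _ _ _ uA] _] := GA.
  by apply: uA; [exact: Gx|exact: Gy].
Qed.

Definition subalgebra (G : set B) : Type := set_type (generated_subalgebra G).

Section Instances.
Variable G : set B.
Let P := [pred x | x \in generated_subalgebra G].

HB.instance Definition _ := SubChoice.copy (subalgebra G)
  (set_type (generated_subalgebra G)).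

Fact subalgebra_meet_closed : meet_closed P.
Proof.
move=> x y; rewrite !inE; have [_ _ _ iG _] := generated_subalgebraP G.
exact: iG.
Qed.

Fact subalgebra_join_closed : join_closed P.
Proof.
move=> x y; rewrite !inE; have [_ _ _ _ uG] := generated_subalgebraP G.
exact: uG.
Qed.

Fact subalgebra_bot : \bot \in P.
Proof. by rewrite !inE; case: (generated_subalgebraP G). Qed.

Fact subalgebra_top : \top \in P.
Proof. by rewrite !inE; case: (generated_subalgebraP G). Qed.

HB.instance Definition _ := Order.SubChoice_isTBSubLattice.Build
  d B _ d (subalgebra G) subalgebra_meet_closed subalgebra_join_closed
  subalgebra_bot subalgebra_top.

Lemma val_subalgebraI (x y : subalgebra G) : val (x `&` y) = val x `&` val y.
Proof. by []. Qed.

Lemma val_subalgebraU (x y : subalgebra G) : val (x `|` y) = val x `|` val y.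
Proof. by []. Qed.

Lemma val_subalgebra0 : val (\bot : subalgebra G) = \bot.
Proof. by []. Qed.

Lemma val_subalgebra1 : val (\top : subalgebra G) = \top.
Proof. by []. Qed.

Fact subalgebra_meetUl :
  @left_distributive (subalgebra G) (subalgebra G) Order.meet Order.join.
Proof.
move=> x y z; apply: val_inj.
by rewrite val_subalgebraI !val_subalgebraU !val_subalgebraI meetUl.
Qed.

HB.instance Definition _ := Order.Lattice_Meet_isDistrLattice.Build
  d (subalgebra G) subalgebra_meetUl.

Fact subalgebra_compl_subproof (x : subalgebra G) :
  ~` val x \in generated_subalgebra G.
Proof.
have [_ _ cG _ _] := generated_subalgebraP G.
by rewrite inE; apply: cG; have := valP x; rewrite inE.
Qed.

Definition subalgebra_compl (x : subalgebra G) : subalgebra G :=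
  Sub (~` val x) (subalgebra_compl_subproof x).

Fact subalgebra_joinxC (x : subalgebra G) : x `|` subalgebra_compl x = \top.
Proof.
by apply: val_inj; rewrite val_subalgebraU SubK joinxC val_subalgebra1.
Qed.

Fact subalgebra_meetxC (x : subalgebra G) : x `&` subalgebra_compl x = \bot.
Proof.
by apply: val_inj; rewrite val_subalgebraI SubK meetxC val_subalgebra0.
Qed.

HB.instance Definition _ := Order.TBDistrLattice_hasComplement.Build
  d (subalgebra G) subalgebra_joinxC subalgebra_meetxC.

End Instances.
End Subalgebra.

Section Quotient.
Context {d : Order.disp_t} {B : ctbDistrLatticeType d}.
Local Open Scope order_scope.

Record ideal := Ideal {
  ideal_set :> B -> Prop;
  ideal_bot : ideal_set \bot;
  ideal_join : forall x y, ideal_set x -> ideal_set y -> ideal_set (x `|` y);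
  ideal_le : forall x y, x <= y -> ideal_set y -> ideal_set x }.

Definition symdiff (x y : B) : B := (x `\` y) `|` (y `\` x).

Section Instances.
Variable I : ideal.

Definition ideal_equiv : rel B := fun x y => `[< I (symdiff x y) >].

Lemma joinx_symdiff x y : x `|` symdiff x y = x `|` y.
Proof. by rewrite /symdiff joinA (join_l (leBx x y)) diffKU joinC. Qed.

Lemma symdiffC x y : symdiff x y = symdiff y x.
Proof. by rewrite /symdiff joinC. Qed.

Lemma ideal_equivP x y :
  reflect (exists2 z, I z & x `|` z = y `|` z) (ideal_equiv x y).
Proof.
apply: (iffP (asboolP _)) => [Ixy|[z Iz xyz]].
  exists (symdiff x y) => //.
  by rewrite joinx_symdiff symdiffC joinx_symdiff joinC.
apply: ideal_le Iz; rewrite leUx !leBLR.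
by rewrite -xyz leUl xyz leUl.
Qed.

Fact ideal_equiv_refl : reflexive ideal_equiv.
Proof.
by move=> x; apply/ideal_equivP; exists \bot => //; exact: ideal_bot.
Qed.

Fact ideal_equiv_sym : symmetric ideal_equiv.
Proof. by move=> x y; rewrite /ideal_equiv /symdiff joinC. Qed.

Fact ideal_equiv_trans : transitive ideal_equiv.
Proof.
move=> y x z /ideal_equivP[u Iu xy] /ideal_equivP[v Iv yz].
apply/ideal_equivP; exists (u `|` v); first exact: ideal_join.
by rewrite joinA xy joinAC yz joinAC -joinA.
Qed.

Canonical ideal_equiv_equiv :=
  EquivRel ideal_equiv ideal_equiv_refl ideal_equiv_sym ideal_equiv_trans.

Definition quotient : Type := {eq_quot ideal_equiv}%qT.

HB.instance Definition _ := Choice.copy quotient {eq_quot ideal_equiv}%qT.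
HB.instance Definition _ :=
  EqQuotient.copy quotient {eq_quot ideal_equiv}%qT.

Local Open Scope quotient_scope.

Lemma quotient_eqP (x y : B) :
  reflect (exists2 z, I z & x `|` z = y `|` z) (x == y %[mod quotient]).
Proof. by rewrite piE; exact: ideal_equivP. Qed.

Definition quotient_meet := lift_op2 quotient (@Order.meet d B).
Definition quotient_join := lift_op2 quotient (@Order.join d B).
Definition quotient_compl := lift_op1 quotient (@Order.compl d B).
Definition quotient_bot := lift_cst quotient (\bot : B).
Definition quotient_top := lift_cst quotient (\top : B).

Fact repr_quotient (x : B) :
  exists2 z, I z & repr (\pi_quotient x) `|` z = x `|` z.
Proof. by apply/quotient_eqP; rewrite reprK. Qed.

Fact pi_quotient_meet :
  {morph \pi_quotient : x y / x `&` y >-> quotient_meet x y}.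
Proof.
move=> x y; unlock quotient_meet; apply/eqP/quotient_eqP.
have [u Iu xu] := repr_quotient x; have [v Iv yv] := repr_quotient y.
exists (u `|` v); first exact: ideal_join.
rewrite !joinIl [in RHS]joinA xu -joinA; congr (_ `&` _).
by rewrite [in RHS]joinCA yv joinCA.
Qed.
Canonical pi_quotient_meet_morph := PiMorph2 pi_quotient_meet.

Fact pi_quotient_join :
  {morph \pi_quotient : x y / x `|` y >-> quotient_join x y}.
Proof.
move=> x y; unlock quotient_join; apply/eqP/quotient_eqP.
have [u Iu xu] := repr_quotient x; have [v Iv yv] := repr_quotient y.
exists (u `|` v); first exact: ideal_join.
by rewrite joinACA -xu -yv joinACA.
Qed.
Canonical pi_quotient_join_morph := PiMorph2 pi_quotient_join.

Fact pi_quotient_compl :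
  {morph \pi_quotient : x / ~` x >-> quotient_compl x}.
Proof.
move=> x; unlock quotient_compl; apply/eqP/quotient_eqP.
have [u Iu xu] := repr_quotient x; exists u => //.
by rewrite -!complB -(joinBK u) -xu joinBK.
Qed.
Canonical pi_quotient_compl_morph := PiMorph1 pi_quotient_compl.

Canonical pi_quotient_bot := PiConst quotient_bot.
Canonical pi_quotient_top := PiConst quotient_top.

Definition quotient_le : rel quotient := fun x y => quotient_meet x y == x.
Definition quotient_lt : rel quotient :=
  fun x y => (y != x) && quotient_le x y.

Fact quotient_meetC : commutative quotient_meet.
Proof. by elim/quotW=> x; elim/quotW=> y; rewrite !piE meetC. Qed.

Fact quotient_joinC : commutative quotient_join.
Proof. by elim/quotW=> x; elim/quotW=> y; rewrite !piE joinC. Qed.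

Fact quotient_meetA : associative quotient_meet.
Proof.
by elim/quotW=> x; elim/quotW=> y; elim/quotW=> z; rewrite !piE meetA.
Qed.

Fact quotient_joinA : associative quotient_join.
Proof.
by elim/quotW=> x; elim/quotW=> y; elim/quotW=> z; rewrite !piE joinA.
Qed.

Fact quotient_joinKI y x : quotient_meet x (quotient_join x y) = x.
Proof. by elim/quotW: x => x; elim/quotW: y => y; rewrite !piE joinKI. Qed.

Fact quotient_meetKU y x : quotient_join x (quotient_meet x y) = x.
Proof. by elim/quotW: x => x; elim/quotW: y => y; rewrite !piE meetKU. Qed.

Fact quotient_meetUl : left_distributive quotient_meet quotient_join.
Proof.
by elim/quotW=> x; elim/quotW=> y; elim/quotW=> z; rewrite !piE meetUl.
Qed.

Fact quotient_meetxx : idempotent_op quotient_meet.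
Proof. by elim/quotW=> x; rewrite !piE meetxx. Qed.

HB.instance Definition _ := Order.isMeetJoinDistrLattice.Build d quotient
  (fun _ _ => erefl) (fun _ _ => erefl) quotient_meetC quotient_joinC
  quotient_meetA quotient_joinA quotient_joinKI quotient_meetKU
  quotient_meetUl quotient_meetxx.

Fact quotient_le0x (x : quotient) : quotient_bot <= x.
Proof. by apply/eqP; elim/quotW: x => x; rewrite !piE meet0x. Qed.

Fact quotient_lex1 (x : quotient) : x <= quotient_top.
Proof. by apply/eqP; elim/quotW: x => x; rewrite !piE meetx1. Qed.

HB.instance Definition _ := Order.hasBottom.Build d quotient quotient_le0x.
HB.instance Definition _ := Order.hasTop.Build d quotient quotient_lex1.

Fact quotient_joinxC (x : quotient) : x `|` quotient_compl x = \top.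
Proof.
rewrite -[_ `|` _]/(quotient_join _ _) -[\top]/quotient_top.
by elim/quotW: x => x; rewrite !piE joinxC.
Qed.

Fact quotient_meetxC (x : quotient) : x `&` quotient_compl x = \bot.
Proof.
rewrite -[_ `&` _]/(quotient_meet _ _) -[\bot]/quotient_bot.
by elim/quotW: x => x; rewrite !piE meetxC.
Qed.

HB.instance Definition _ := Order.TBDistrLattice_hasComplement.Build
  d quotient quotient_joinxC quotient_meetxC.

End Instances.
End Quotient.

Arguments ideal {d} B.

Section Measure.
Context {d : Order.disp_t} (R : realType) (B : ctbDistrLatticeType d).

(* Finiteness is the fact that values are taken in [R]; [mu \bot = 0] follows
   from additivity. *)
Definition finitely_additive_measure (mu : B -> R) : Prop :=
  (forall x, 0 <= mu x) /\
  (forall x y, (x `&` y = \bot)%O -> mu (x `|` y)%O = mu x + mu y).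

Definition supports_measure : Prop :=
  exists mu : B -> R,
    finitely_additive_measure mu /\ (forall x, x <> \bot%O -> 0 < mu x).

End Measure.

(* [xsection S n] is the vertical section S(n), and [`I_n] is the set of
   predecessors of n. *)
Definition slaloms : set (set (nat * nat)) :=
  [set S | forall n, finite_set (xsection S n) /\
                     (#|` fset_set (xsection S n)| < 2 ^ n)%N].

Definition null_slaloms (R : realType) : set (set (nat * nat)) :=
  [set S | [/\ slaloms S,
               forall n, xsection S n `<=` `I_(2 ^ n) &
               (2 ^- n * #|` fset_set (xsection S n)|%:R : R) @[n --> \oo]
                 --> (0 : R)]].

Definition box (n : nat) : set (nat * nat) := `I_n `*` `I_(2 ^ n).

Definition Omega : set (set (nat * nat) * nat) :=
  [set p | slaloms p.1 /\ p.1 `<=` box p.2].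

Definition T_slalom (A : set (nat * nat)) : set Omega :=
  [set p | A `&` box (val p).2 `<=` (val p).1].

Definition T_node (q : Omega) : set Omega :=
  [set p | ((val q).2 <= (val p).2)%N /\
           (val p).1 `&` box (val q).2 = (val q).1].

Definition T_generators (R : realType) : set (set Omega) :=
  [set T_slalom A | A in null_slaloms R] `|` range T_node.

Definition T_V (R : realType) : Type := subalgebra (T_generators R).

HB.instance Definition _ (R : realType) :=
  Order.CTBDistrLattice.copy (T_V R) (subalgebra (T_generators R)).

Section Fin.
Variable R : realType.

Definition finite_members : set (T_V R) := [set X | finite_set (val X)].

Fact finite_members_bot : finite_members \bot%O.
Proof. exact: finite_set0. Qed.

Fact finite_members_join (X Y : T_V R) :
  finite_members X -> finite_members Y -> finite_members (X `|` Y)%O.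
Proof. by move=> fX fY; rewrite /finite_members/= finite_setU. Qed.

Fact finite_members_le (X Y : T_V R) :
  (X <= Y)%O -> finite_members Y -> finite_members X.
Proof. by move=> /subsetPset XY; exact: sub_finite_set. Qed.

Definition Fin : ideal (T_V R) :=
  Ideal finite_members_bot finite_members_join finite_members_le.

End Fin.

(* Main.v *)
(* Suppose [mu] is a strictly positive measure.  If for every j some finite
   slalom A_j of densities at most 2^-(j+1) had [mu T_(A_j) <= 1/(j+1)], then
   the union A of the A_j would lie in V and [mu T_A] would vanish although T_A
   is infinite.  So for some j all such finite slaloms satisfy
   [mu T_A > 1/(j+1)].  Now take N of them such that any 2^(j+1) of them
   partition some level into equal parts: a slalom never contains a full level,
   so any 2^(j+1) of the sets T_A have a finite intersection.  Hence the N
   measures sum to less than 2^(j+1) times the total mass, which is false for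
   large N. *)
Require Import Defs.
From mathcomp Require Import all_boot all_order all_algebra.
From mathcomp Require Import generic_quotient finmap zify lra.
From mathcomp Require Import all_classical all_reals all_analysis.

Set Implicit Arguments.
Unset Strict Implicit.
Unset Printing Implicit Defensive.

Import Order.Theory GRing.Theory Num.Theory.
Import numFieldNormedType.Exports.

Local Open Scope classical_set_scope.
Local Open Scope ring_scope.

(** * Finitely additive measures and families of bounded overlap *)

Section FinitelyAdditive.
Context {d : Order.disp_t} (R : realType) (B : ctbDistrLatticeType d).
Variable mu : B -> R.
Hypothesis mu_fam : finitely_additive_measure mu.
Implicit Types x y : B.

Lemma fam_ge0 x : 0 <= mu x. Proof. by case: mu_fam. Qed.

Lemma fam0 : mu \bot%O = 0.
Proof.
by have [_ /(_ \bot%O \bot%O (meetxx _))] := mu_fam; rewrite joinxx; lra.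
Qed.

Lemma famIC x y : mu x = mu (x `&` y)%O + mu (x `&` ~` y)%O.
Proof.
have [_ <-] := mu_fam; first by rewrite -meetUr joinxC meetx1.
by rewrite meetACA meetxC meetx0.
Qed.

Lemma fam_le x y : (x <= y)%O -> mu x <= mu y.
Proof.
by move=> /meet_r xy; rewrite (famIC y x) xy lerDl fam_ge0.
Qed.

(* If no point lies in more than [q] of the sets [X i], then the sum of their
   indicator functions is at most [q]; this is its integral over [y]. *)
Lemma fam_sum_le (I : eqType) (X : I -> B) (r : seq I) (q : nat) y :
  (forall s, subseq s r -> size s = q.+1 ->
     (y `&` \meet_(i <- s) X i = \bot)%O) ->
  \sum_(i <- r) mu (y `&` X i)%O <= q%:R * mu y.
Proof.
elim: r q y => [|i r IH] q y yr.
  by rewrite big_nil mulr_ge0 ?fam_ge0.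
rewrite big_cons.
(* Cut [y] along [X i]. Outside [X i] the bound [q] is kept; inside, [X i] is already one of the [q]
   allowed sets, so induction with [q - 1] leaves room for the term of [i]. *)
have -> : \sum_(j <- r) mu (y `&` X j)%O =
    \sum_(j <- r) mu (y `&` X i `&` X j)%O +
    \sum_(j <- r) mu (y `&` ~` X i `&` X j)%O.
  rewrite -big_split; apply: eq_bigr => j _.
  by rewrite (famIC _ (X i)) /= meetAC [in X in _ + X]meetAC.
have outi : \sum_(j <- r) mu (y `&` ~` X i `&` X j)%O <=
    q%:R * mu (y `&` ~` X i)%O.
  apply: IH => s sr sq; rewrite meetAC yr ?meet0x//.
  exact: subseq_trans sr (subseq_cons _ _).
rewrite (famIC y (X i)) mulrDr addrA lerD// => {outi}.
case: q yr => [|q] yr.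
  have yi : (y `&` X i = \bot)%O.
    have /(_ [:: i]) := yr; rewrite big_seq1; apply => //.
    by rewrite /= eqxx sub0seq.
  rewrite yi fam0 mul0r add0r big1// => j _.
  by rewrite meet0x fam0.
rewrite mulrSr mulrDl mul1r addrC lerD2r; apply: IH => s sr sq.
have := yr (i :: s); rewrite big_cons meetA; apply; last by rewrite /= sq.
by rewrite /= eqxx.
Qed.

End FinitelyAdditive.

(** * Slaloms listed level by level *)

Section Slaloms.
Implicit Types (a : nat -> seq nat) (A : set (nat * nat)).

Definition slalom_of a : set (nat * nat) := [set p | p.2 \in a p.1].

Lemma xsection_slalom_of a n : xsection (slalom_of a) n = [set` a n].
Proof. by rewrite xsectionE. Qed.

Lemma card_slalom_of a n :
  (#|` fset_set (xsection (slalom_of a) n)| <= size (a n))%N.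
Proof.
rewrite xsection_slalom_of.
have -> : [set` a n] = [set` [fset x in a n]%fset].
  by apply/seteqP; split => x /=; rewrite inE.
by rewrite set_fsetK card_fseq size_undup.
Qed.

(** Density zero in the form of integer inequalities, one for each [j], keeps real numbers out of
    the constructions below. *)
Lemma slalom_of_null (R : realType) a :
  (forall n m, m \in a n -> (m < 2 ^ n)%N) ->
  (forall n, (size (a n) < 2 ^ n)%N) ->
  (forall j, \forall n \near \oo, (size (a n) * 2 ^ j <= 2 ^ n)%N) ->
  null_slaloms R (slalom_of a).
Proof.
move=> a_lt a_size a_null; split.
- move=> n; split; last exact: leq_ltn_trans (card_slalom_of _ _) (a_size n).
  by rewrite xsection_slalom_of; exact: finite_seq.
- by move=> n; rewrite xsection_slalom_of => m /a_lt.
apply/cvgrPdist_le => e e0.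
have [j je] : exists j, 2 ^- j <= e :> R.
  (* For this [j] one has [e^-1 < j < 2 ^ j]. *)
  exists (Num.trunc e^-1).+1.
  rewrite invf_ple ?posrE ?exprn_gt0//.
  apply: le_trans (ltW (truncnS_gt _)) _.
  by rewrite -natrX ler_nat ltnW// ltn_expl.
apply: filterS (a_null j) => n ajn.
rewrite sub0r normrN ger0_norm ?mulr_ge0 ?invr_ge0 ?exprn_ge0//.
apply: le_trans je.
rewrite ler_pdivrMl ?exprn_gt0// ler_pdivlMr ?exprn_gt0//.
rewrite -!natrX -natrM ler_nat; apply: leq_trans ajn.
by rewrite leq_mul2r card_slalom_of orbT.
Qed.

(* The bound on the sizes forces the levels up to [j] to be empty. *)
Definition thin (j : nat) a : Prop :=
  [/\ forall n m, m \in a n -> (m < 2 ^ n)%N,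
      forall n, (size (a n) * 2 ^ j.+1 <= 2 ^ n)%N &
      \forall n \near \oo, a n = [::]].

Lemma thin_nil j a n : thin j a -> (n <= j)%N -> a n = [::].
Proof.
move=> [_ /(_ n) a_size _] nj; apply/eqP; rewrite -size_eq0; apply/eqP.
have : (2 ^ n < 2 ^ j.+1)%N by rewrite ltn_exp2l.
by case: (size _) a_size => //; nia.
Qed.

Lemma thin_null (R : realType) j a : thin j a -> null_slaloms R (slalom_of a).
Proof.
move=> [a_lt a_size a_nil]; apply: slalom_of_null => //.
- move=> n; have := a_size n; have := expn_gt0 2 n; have := expn_gt0 2 j.
  by rewrite expnS; nia.
- by move=> i; apply: filterS a_nil => n ->.
Qed.

(** Cutting at [j < n] keeps each level finite and loses nothing when [f j] is thin for [j], since
    then [f j n] is empty for [n <= j]. *)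
Definition diagonal (f : nat -> nat -> seq nat) (n : nat) : seq nat :=
  flatten [seq f j n | j <- iota 0 n].

Lemma mem_diagonal (f : nat -> nat -> seq nat) j n m :
  (j < n)%N -> m \in f j n -> m \in diagonal f n.
Proof.
by move=> jn mf; apply/flatten_mapP; exists j => //; rewrite mem_iota.
Qed.

(** Geometric series: the densities [2 ^- j.+1] over all [j >= J] add up to [2 ^- J], and a finite
    part stays strictly below. *)
Lemma sum_half_powers (s : nat -> nat) n :
  (forall j, s j * 2 ^ j.+1 <= 2 ^ n)%N ->
  forall J, ((\sum_(J <= j < n) s j) * 2 ^ J < 2 ^ n)%N.
Proof.
move=> sn J; have [nJ|Jn] := leqP n J.
  by rewrite big_geq// mul0n expn_gt0.
(* Downward induction on [J], run as induction on [k]. *)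
have [k ->] : exists k, J = (n - k)%N by exists (n - J)%N; lia.
elim: k => [|k IH]; first by rewrite subn0 big_geq// expn_gt0.
have [nk|kn] := leqP n k.
  by have -> : (n - k.+1 = n - k)%N by lia.
have E : (n - k = (n - k.+1).+1)%N by lia.
rewrite big_ltn; last lia.
have := sn (n - k.+1)%N; move: IH; rewrite E expnS.
by set S := bigop _ _ _; lia.
Qed.

(** Beyond some level the first [J] sequences are empty, and the others have total density below
    [2 ^- J]. *)
Lemma diagonal_null (R : realType) f :
  (forall j, thin j (f j)) -> null_slaloms R (slalom_of (diagonal f)).
Proof.
move=> f_thin.
have size_diag n : size (diagonal f n) = (\sum_(0 <= j < n) size (f j n))%N.
  by rewrite size_flatten sumnE /shape -map_comp big_map /index_iota subn0.
have sum_lt n := @sum_half_powers (fun j => size (f j n)) n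
  (fun j => let: And3 _ fs _ := f_thin j in fs n).
apply: slalom_of_null.
- move=> n m /flatten_mapP[j _]; have [+ _ _] := f_thin j; exact.
- by move=> n; rewrite size_diag; have := sum_lt n 0%N; rewrite muln1.
- move=> J.
  have f_nil : \forall n \near \oo, forall j, (j < J)%N -> f j n = [::].
    elim: J => [|J IH]; first exact: nearW.
    have [_ _] := f_thin J; apply: filterS2 IH => n fn fJ j.
    by rewrite ltnS leq_eqVlt => /predU1P[->|/fn].
  near=> n.
  have Jn : (J <= n)%N by near: n; exact: nbhs_infty_ge.
  rewrite size_diag (big_cat_nat (leq0n J) Jn)//= big_nat_cond big1 ?add0n.
    exact/ltnW/sum_lt.
  move=> j /andP[/andP[_ jJ] _].
  by rewrite (near f_nil n).
Unshelve. all: by end_near.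
Qed.

End Slaloms.

(** * Thin slaloms any [2 ^ j.+1] of which fill a level *)

Section Splitting.
Variables (T : finType) (j : nat).

(* At level [j.+1 + k], the members of the [k]-th sequence of length [2 ^ j.+1]
   over [T] receive consecutive intervals cutting [0, 2 ^ n) into equal parts. *)
Let tuples : seq (seq T) := [seq tval t | t : (2 ^ j.+1).-tuple T].
Let members (n : nat) : seq T := nth [::] tuples (n - j.+1).

Definition splitting (i : T) (n : nat) : seq nat :=
  if (j < n)%N && (i \in members n) then
    iota (index i (members n) * 2 ^ (n - j.+1)) (2 ^ (n - j.+1))
  else [::].

Let size_members i n : i \in members n -> size (members n) = (2 ^ j.+1)%N.
Proof.
rewrite /members; have [kt|kt] := ltnP (n - j.+1)%N (size tuples).
  by have /mapP[t _ ->] := mem_nth [::] kt; rewrite size_tuple.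
by rewrite nth_default.
Qed.

Lemma splitting_thin i : thin j (splitting i).
Proof.
split.
- move=> n m; rewrite /splitting; case: ifP => // /andP[jn im].
  have := im; rewrite -[i \in _]index_mem (size_members im) mem_iota.
  rewrite -[in (2 ^ n)%N](subnKC jn) expnD.
  set b := index _ _; set h := (2 ^ (_ - _))%N; set q := (2 ^ _)%N; nia.
- move=> n; rewrite /splitting; case: ifP => // /andP[jn _].
  by rewrite size_iota -expnD subnK.
(* There are finitely many tuples; later levels read the default [[::]] of [nth]. *)
- exists (j.+1 + size tuples)%N => // n /= jn; rewrite /splitting.
  by rewrite /members nth_default ?andbF//; lia.
Qed.

Lemma splitting_cover (s : seq T) : uniq s -> size s = (2 ^ j.+1)%N ->
  exists n, forall m, (m < 2 ^ n)%N -> exists2 i, i \in s & m \in splitting i n.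
Proof.
move=> s_uniq s_size.
have st : s \in tuples.
  have /eqP s_size' := s_size.
  by apply/mapP; exists (Tuple s_size'); rewrite ?mem_enum.
exists (j.+1 + index s tuples)%N => m.
set n := addn _ _ => mn; set h := (2 ^ (n - j.+1))%N.
have h0 : (0 < h)%N by rewrite expn_gt0.
have membersE : members n = s by rewrite /members addKn nth_index.
have bs : (m %/ h < size s)%N.
  by rewrite s_size ltn_divLR// -expnD subnKC//; lia.
have /hasP[i0 _ _] : has predT s by rewrite has_predT s_size expn_gt0.
(* Intervals have length [h], so [m] lies in the one numbered [m %/ h]; as [s] has no repetition,
   this number is the index of its owner. *)
exists (nth i0 s (m %/ h)); first exact: mem_nth.
rewrite /splitting membersE mem_nth// andbT ltn_addr//= index_uniq// mem_iota.
by rewrite -/h {2 3}(divn_eq m h) leq_addr ltn_add2l ltn_mod.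
Qed.

End Splitting.

(** * Finite and infinite subsets of [Omega] *)

Section T_slalom.
Implicit Types A : set (nat * nat).

Lemma subset_T_slalom A A' : A `<=` A' -> T_slalom A' `<=` T_slalom A.
Proof. by move=> AA' p A'p x [Ax px]; apply: A'p; split => //; exact: AA'. Qed.

Lemma slaloms_sub A A' : A `<=` A' -> slaloms A' -> slaloms A.
Proof.
move=> AA' A'n n; have [A'fin A'lt] := A'n n.
have sub : xsection A n `<=` xsection A' n by exact: le_xsection.
have Afin := sub_finite_set sub A'fin; split => //.
apply: leq_ltn_trans A'lt; apply: fsubset_leq_card.
by rewrite -fset_set_sub.
Qed.

(** For every [n], the trace of [A] on [box n], paired with [n], is a member. *)
Lemma T_slalom_infinite A : slaloms A -> infinite_set (T_slalom A).
Proof.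
move=> slA finA; apply: infinite_nat.
apply: (sub_finite_set _ (finite_image (fun p : Omega => (val p).2) finA)).
move=> n _.
have On : (A `&` box n, n) \in Omega.
  by apply/mem_set; split => //=; exact: slaloms_sub slA.
by exists (SigSub On).
Qed.

Lemma finite_powerset (T : choiceType) (D : set T) :
  finite_set D -> finite_set [set X : set T | X `<=` D].
Proof.
move=> Dfin.
apply: (sub_finite_set _ (finite_image (fun X : {fset T} => [set` X])
  (finite_fset (fpowerset (fset_set D))))).
move=> X XD; have Xfin := sub_finite_set XD Dfin.
exists (fset_set X); last by rewrite fset_setK.
by rewrite /= fpowersetE -fset_set_sub.
Qed.

Lemma finite_Omega_le n : finite_set [set p : Omega | ((val p).2 <= n)%N].
Proof.
have fin : finite_set ([set S | S `<=` box n] `*` `I_n.+1).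
  by apply: finite_setX => //; apply: finite_powerset; exact: finite_setX.
have val_injOn : {in val @^-1` ([set S | S `<=` box n] `*` `I_n.+1) &,
    injective (val : Omega -> _)} by move=> p q _ _; exact: val_inj.
apply: sub_finite_set (finite_preimage val_injOn fin).
move=> p /= pn; have [_ pbox] := set_valP p; split; last by rewrite /= ltnS.
move=> x /pbox[x1 x2]; split; first exact: leq_trans x1 pn.
by apply: leq_trans x2 _; rewrite leq_exp2l.
Qed.

(** A common member of level above [n] would have all [2 ^ n] points in its section at [n], against
    the strict bound on slaloms. *)
Lemma T_slalom_cover_finite (I : Type) (D : set I)
    (X : I -> set (nat * nat)) n :
  (forall m, (m < 2 ^ n)%N -> exists2 i, D i & X i (n, m)) ->
  finite_set (\bigcap_(i in D) T_slalom (X i)).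
Proof.
move=> cover; apply: sub_finite_set (finite_Omega_le n) => p pX /=.
rewrite leqNgt; apply/negP => np.
have [/(_ n)[pfin pn] _] := set_valP p.
have sub : `I_(2 ^ n) `<=` xsection (val p).1 n.
  move=> m mn; have [i Di Xnm] := cover m mn.
  apply/xsectionP; apply: pX Di _ _; split => //; split => //=.
  by apply: leq_trans mn _; rewrite leq_exp2l// ltnW.
have := leq_card_fset_set pfin (subset_card_le sub).
by rewrite leqNgt pn.
Qed.

End T_slalom.

(** * Passage to the quotient by [Fin] *)

Section Classes.
Variable R : realType.
Local Open Scope order_scope.
Local Open Scope quotient_scope.

Let piF (x : T_V R) : quotient (Fin R) := \pi_(quotient (Fin R)) x.

Lemma pi_Fin_eq0 (x : T_V R) : piF x = \bot <-> finite_set (val x).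
Proof.
have -> : \bot = piF \bot by rewrite -[LHS]/(quotient_bot _) /piF piE.
split=> [/eqP/quotient_eqP[z zfin xz]|xfin].
  by apply: sub_finite_set zfin; apply/subsetPset; rewrite -[z]join0x -xz leUl.
by apply/eqP/quotient_eqP; exists x => //; rewrite joinxx join0x.
Qed.

(** The default bottom of [insubd] is not reached when [A] is in V, as [T_slalom A] is then a
    generator. *)
Definition T_class (A : set (nat * nat)) : quotient (Fin R) :=
  piF (insubd \bot (T_slalom A)).

Lemma T_slalom_val A : null_slaloms R A ->
  val (insubd (\bot : T_V R) (T_slalom A)) = T_slalom A.
Proof.
move=> nullA; apply: insubdK; apply/mem_set => B [_]; apply.
by left; exists A.
Qed.

Lemma T_class_neq0 A : null_slaloms R A -> T_class A <> \bot.
Proof.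
move=> nullA /pi_Fin_eq0; rewrite T_slalom_val//; apply: T_slalom_infinite.
by case: nullA.
Qed.

Lemma T_class_le A A' : null_slaloms R A -> null_slaloms R A' ->
  A `<=` A' -> T_class A' <= T_class A.
Proof.
move=> nullA nullA' AA'; apply/meet_idPl.
rewrite /T_class /piF -[_ `&` _]pi_quotient_meet; congr (\pi _).
apply/meet_idPl/subsetPset; rewrite !T_slalom_val//; exact: subset_T_slalom.
Qed.

Lemma T_class_cover (I : eqType) (s : seq I) (X : I -> set (nat * nat)) n :
  (forall i, null_slaloms R (X i)) ->
  (forall m, (m < 2 ^ n)%N -> exists2 i, i \in s & X i (n, m)) ->
  \meet_(i <- s) T_class (X i) = \bot.
Proof.
move=> nullX cover.
pose t i : T_V R := insubd \bot (T_slalom (X i)).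
(* The projection commutes with finite meets, so finiteness can be checked on representatives. *)
have -> : \meet_(i <- s) T_class (X i) = piF (\meet_(i <- s) t i).
  elim: s {cover} => [|i s IH].
    by rewrite !big_nil -[LHS]/(quotient_top _) /piF piE.
  by rewrite !big_cons IH /T_class /piF [RHS]pi_quotient_meet.
apply/pi_Fin_eq0; apply: sub_finite_set (T_slalom_cover_finite cover).
move=> p tp i si; rewrite -T_slalom_val//.
have le_t : \meet_(i <- s) t i <= t i by exact: meets_inf_seq.
by have /subsetPset := le_t; exact.
Qed.

End Classes.

Theorem proposition5p21 (R : realType) :
  ~ supports_measure R (quotient (Fin R)).
Proof.
move=> [mu [mu_fam mu_gt0]].
have [j mu_gt] : exists j, forall a, thin j a ->
    j.+1%:R^-1 < mu (T_class R (slalom_of a)).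
  apply: contrapT => /forallNP no_j.
  have /choice[f f_small] j : exists a, thin j a /\
      mu (T_class R (slalom_of a)) <= j.+1%:R^-1.
    have /existsNP[a /not_implyP[a_thin /negP]] := no_j j.
    by rewrite -leNgt; exists a.
  have f_thin j := (f_small j).1.
  have null_f := diagonal_null R f_thin.
  have mu_diag j : mu (T_class R (slalom_of (diagonal f))) <= j.+1%:R^-1.
    apply: le_trans (f_small j).2; apply: fam_le => //.
    apply: T_class_le => //; first exact: thin_null (f_thin j).
    move=> [n m] /= fm; apply: mem_diagonal (fm).
    rewrite ltnNge; apply/negP => /(thin_nil (f_thin j)) fn.
    by rewrite /slalom_of/= fn in fm.
  have := mu_gt0 _ (T_class_neq0 null_f); set e := mu _ in mu_diag *.
  (* At this index [j.+1] exceeds [e^-1], so the bound falls below [e]. *)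
  move=> e0; have := mu_diag (Num.trunc e^-1).
  apply/negP; rewrite -ltNge invf_plt ?posrE//; exact: truncnS_gt.
pose M := mu \top%O; pose q := (2 ^ j.+1)%N.
have M0 : 0 <= M by exact: fam_ge0.
(* Chosen so that [N / j.+1] exceeds [q * M]. *)
pose N := (Num.trunc (j.+1%:R * (q%:R * M))).+1.
pose X (i : 'I_N) := slalom_of (splitting j i).
have nullX i : null_slaloms R (X i) := thin_null R (splitting_thin j i).
have lower : N%:R * j.+1%:R^-1 <=
    \sum_(i <- enum 'I_N) mu (\top `&` T_class R (X i))%O.
  have -> : N%:R * j.+1%:R^-1 = \sum_(i <- enum 'I_N) j.+1%:R^-1 :> R.
    by rewrite big_enum sumr_const card_ord mulr_natl.
  apply: ler_sum => i _; rewrite meet1x; exact/ltW/mu_gt/splitting_thin.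
(* Any [q] distinct splittings have classes with zero meet, so the overlap is at most [q.-1]. *)
have upper :
    \sum_(i <- enum 'I_N) mu (\top `&` T_class R (X i))%O <= q.-1%:R * M.
  apply: fam_sum_le => // s s_sub s_size; rewrite meet1x.
  have s_uniq : uniq s := subseq_uniq s_sub (enum_uniq _).
  have [|n cover] := @splitting_cover _ j s s_uniq.
    by rewrite s_size prednK// expn_gt0.
  exact: T_class_cover cover.
have := le_trans lower upper; apply/negP; rewrite -ltNge.
rewrite ltr_pdivlMr ?ltr0n// mulrC.
apply: le_lt_trans (truncnS_gt _); rewrite ler_wpM2l// ler_wpM2r//.
by rewrite ler_nat leq_pred.
Qed.
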